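(* Let $G$ be a profinite group, $E$ a Weyl-$G$-sheaf of $\mathbb{Q}$-modules over $\mathcal{S}G$, and $K$ a closed subgroup of $G$. Then for any germ $s_K\in E_K$ there are an open normal subgroup $N$ of $G$ and an $NK$-equivariant section $$s\colon O_{NK}(N,NK)\longrightarrow E$$ over the neighbourhood $O_{NK}(N,NK)$ of $K$ in $\mathcal{S}G$ that represents $s_K$, i.e. $s(K)=s_K$.
   Context: For a profinite group $G$, $\mathcal{S}G$ is the set of closed subgroups of $G$, topologised as $\lim_N \mathcal{S}(G/N)$ over open normal subgroups $N$ of $G$, where $\mathcal{S}(G/N)$ is finite discrete and the projections are $H\mapsto HN/N$. A basis of open and closed sets is given by $O_G(N,J)=\{L\in\mathcal{S}G\mid NL=J\}$ for $N$ open normal in $G$ and $J$ an open subgroup containing $N$. One has $O_{NK}(N,NK)=\{L\in\mathcal{S}(NK)\mid NL=NK\}=O_G(N,NK)$. $G$ acts on $\mathcal{S}G$ by conjugation. A $G$-sheaf (of $\mathbb{Q}$-modules) over $\mathcal{S}G$ is a continuous $G$-equivariant map $p\colon E\to\mathcal{S}G$ of spaces with continuous $G$-actions such that $(E,p)$ is a sheaf space (étale space) of $\mathbb{Q}$-modules and each $g\colon p^{-1}(x)\to p^{-1}(gx)$ is $\mathbb{Q}$-linear. The stalk is $E_K=p^{-1}(K)$, whose elements are called germs. A Weyl-$G$-sheaf is a $G$-sheaf over $\mathcal{S}G$ such that $K$ acts trivially on $E_K$ for each closed $K\leqslant G$. A section over an open set $U$ is a continuous map $s\colon U\to E$ with $p\circ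 s=\mathrm{Id}_U$; if $U$ is invariant under a subgroup $H$ of $G$, $s$ is $H$-equivariant if $h\,s(h^{-1}u)=s(u)$ for all $h\in H$, $u\in U$. *)

(* Defs.v *)
(* MathComp-Analysis, with the possibly infinite groups of mathcomp.boot.monoid *)
From HB Require Import structures.
From mathcomp Require Import all_boot all_order all_algebra.
From mathcomp Require Import all_classical all_reals all_analysis.

Set Implicit Arguments.
Unset Strict Implicit.
Unset Printing Implicit Defensive.

Import GRing.Theory.

Local Open Scope classical_set_scope.

HB.mixin Record isTopologicalGroup G & Group G & Topological G := {
  mulg_continuous : continuous (fun xy : G * G => (xy.1 * xy.2)%g);
  invg_continuous : continuous (fun x : G => (x^-1)%g)
}.

#[short(type="topologicalGroupType")]
HB.structure Definition TopologicalGroup :=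
  {G of isTopologicalGroup G & Group G & Topological G}.

Definition profinite (G : topologicalGroupType) : Prop :=
  [/\ compact [set: G], hausdorff_space G & totally_disconnected [set: G]].

Definition mulset (G : groupType) (A B : set G) : set G :=
  [set (a * b)%g | a in A & b in B].

Definition conjset (G : groupType) (g : G) (A : set G) : set G :=
  [set (g * a * g^-1)%g | a in A].

Definition subgroup (G : groupType) (A : set G) : Prop :=
  [/\ A 1%g,
      forall x y, A x -> A y -> A (x * y)%g &
      forall x, A x -> A (x^-1)%g].

Definition open_normal_subgroup (G : topologicalGroupType) (N : set G) : Prop :=
  [/\ subgroup N, open N & forall g, conjset g N = N].

Record closed_subgroup (G : topologicalGroupType) := ClosedSubgroup {
  csg :> set G;
  csg_subgroup : subgroup csg;
  csg_closed : closed csg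
}.

HB.instance Definition _ (G : topologicalGroupType) :=
  gen_eqMixin (closed_subgroup G).
HB.instance Definition _ (G : topologicalGroupType) :=
  gen_choiceMixin (closed_subgroup G).

(* HN/N, as a set of cosets of N *)
Definition quotient_image (G : groupType) (H N : set G) : set (set G) :=
  [set [set (h * n)%g | n in N] | h in H].

(* The points of lim_N S(G/N) are the closed subgroups, so its topology is the
   one induced from the product over N of the discrete sets S(G/N).  Enlarging
   the discrete factor S(G/N) to all sets of subsets of G does not change the
   induced topology. *)
Definition to_finite_quotients (G : topologicalGroupType)
    (H : closed_subgroup G) :
    prod_topology (fun _ : set_type (@open_normal_subgroup G) =>
                     discrete_topology (set (set G))) :=
  fun N => quotient_image H (set_val N).

HB.instance Definition _ (G : topologicalGroupType) :=
  Topological.copy (closed_subgroup G)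
    (initial_topology (@to_finite_quotients G)).

Section Conjugation.
Variables (G : topologicalGroupType) (g : G) (K : closed_subgroup G).

Lemma conjset_subgroup : subgroup (conjset g K).
Proof.
have [K1 KM KV] := csg_subgroup K; split.
- by exists 1%g => //; rewrite mulg1 mulgV.
- move=> _ _ [a Ka <-] [b Kb <-]; exists (a * b)%g; first exact: KM.
  by rewrite !mulgA mulgVK.
- move=> _ [a Ka <-]; exists (a^-1)%g; first exact: KV.
  by rewrite !invgM invgK mulgA.
Qed.

Lemma conjset_closed : closed (conjset g K).
Proof.
have -> : conjset g K = (fun x : G => (g^-1 * x * g)%g) @^-1` K.
  apply/seteqP; split => [_ [a Ka <-]|x Kx] /=.
    by rewrite !mulgA mulVg mul1g mulgVK.
  by exists (g^-1 * x * g)%g => //; rewrite !mulgA mulgV mul1g mulgK.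
apply: preimage_closed; last exact: csg_closed.
move=> x _ /=.
have mulc (u v : G -> G) (y : G) : {for y, continuous u} ->
    {for y, continuous v} -> {for y, continuous (fun z => (u z * v z)%g)}.
  move=> cu cv; apply: (@continuous_comp _ _ _ (fun z => (u z, v z))
    (fun xy : G * G => (xy.1 * xy.2)%g)); last exact: mulg_continuous.
  exact: (@cvg_pair _ _ _ (nbhs y) (nbhs (u y)) (nbhs (v y))).
by apply: (mulc (fun z => (g^-1 * z)%g) (fun=> g)); [apply: (mulc (fun=> (g^-1)%g) id) |];
  first [exact: cvg_cst | exact: cvg_id].
Qed.

Definition conj_csg : closed_subgroup G :=
  ClosedSubgroup conjset_subgroup conjset_closed.

End Conjugation.

(* O_H(N, J), with the closed subgroups of a closed subgroup H identified with
   the closed subgroups of G contained in H *)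
Definition O_ (G : topologicalGroupType) (H N J : set G) :
    set (closed_subgroup G) :=
  [set L : closed_subgroup G | L `<=` H /\ mulset N L = J].

Definition fibre (E X : Type) (p : E -> X) (x : X) : Type := {e : E | p e = x}.

(* s restricts to the inverse homeomorphism of p : U -> p(U) *)
Definition local_homeomorphism (E X : topologicalType) (p : E -> X) : Prop :=
  forall e : E, exists (U : set E) (s : X -> E),
    [/\ open U /\ U e, open (p @` U),
        {within U, continuous p}, {within p @` U, continuous s} &
        forall u, U u -> s (p u) = u].

Section SheafSpace.
Variables (E X : topologicalType) (p : E -> X).
Variable M : forall x, GRing.Lmodule rat (fibre p x).

Local Notation stalk x := (GRing.Lmodule.Pack (M x) : lmodType rat).

Definition fibre_product : set (E * E) := [set uv | p uv.1 = p uv.2].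

Definition stalk_add (w : fibre_product) : E :=
  sval ((exist _ (val w).1 (set_valP w) : stalk (p (val w).2)) +
        (exist _ (val w).2 erefl : stalk (p (val w).2)))%R.

Definition stalk_scale (q : rat) (e : E) : E :=
  sval (q *: (exist _ e erefl : stalk (p e)))%R.

(* Opposites are scalar multiples by -1, and continuity of the zero section
   follows from that of e |-> 0 *: e, p being a local homeomorphism. *)
Definition is_sheaf_space : Prop :=
  [/\ local_homeomorphism p, continuous stalk_add &
      forall q, continuous (stalk_scale q)].

End SheafSpace.

Record sheaf_space (X : topologicalType) := SheafSpace {
  total :> topologicalType;
  sproj : total -> X;
  stalk_lmodule : forall x, GRing.Lmodule rat (fibre sproj x);
  sheaf_spaceP : is_sheaf_space stalk_lmodule
}.

Definition stalk (X : topologicalType) (E : sheaf_space X) (x : X) :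
  lmodType rat := GRing.Lmodule.Pack (@stalk_lmodule X E x).

Definition fibre_map (E X : Type) (p : E -> X) (f : E -> E) (f' : X -> X)
    (pf : forall e, p (f e) = f' (p e)) (x : X) (e : fibre p x) :
    fibre p (f' x) :=
  exist _ (f (sval e)) (etrans (pf (sval e)) (congr1 f' (svalP e))).

Record Gsheaf (G : topologicalGroupType) := GSheaf {
  Gsheaf_space :> sheaf_space (closed_subgroup G);
  Gsheaf_proj_continuous : continuous (@sproj _ Gsheaf_space);
  gact : G -> Gsheaf_space -> Gsheaf_space;
  gact1 : forall e, gact 1%g e = e;
  gactM : forall g h e, gact (g * h)%g e = gact g (gact h e);
  gact_continuous :
    continuous (fun ge : G * Gsheaf_space => gact ge.1 ge.2);
  sproj_gact : forall g e, sproj (gact g e) = conj_csg g (sproj e);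
  gact_linear : forall (g : G) (K : closed_subgroup G),
    linear (fibre_map (sproj_gact g) (x := K) :
      stalk Gsheaf_space K -> stalk Gsheaf_space (conj_csg g K))
}.

Definition Weyl (G : topologicalGroupType) (E : Gsheaf G) : Prop :=
  forall (K : closed_subgroup G) (k : G) (e : E),
    csg K k -> sproj e = K -> gact k e = e.

(* A section over U is given by the values on U of a total function; every
   function on U extends, since no stalk is empty. *)
Definition is_section (X : topologicalType) (E : sheaf_space X)
    (U : set X) (s : X -> E) : Prop :=
  [/\ open U, {within U, continuous s} & forall u, U u -> sproj (s u) = u].

Definition invariant_under (G : topologicalGroupType) (H : set G)
    (U : set (closed_subgroup G)) : Prop :=
  forall h L, H h -> U L -> U (conj_csg h L).

Definition equivariant_on (G : topologicalGroupType) (E : Gsheaf G)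
    (H : set G) (U : set (closed_subgroup G))
    (s : closed_subgroup G -> E) : Prop :=
  invariant_under H U /\
  forall h L, H h -> U L -> gact h (s (conj_csg (h^-1)%g L)) = s L.

(* Main.v *)
Require Import Defs.
From mathcomp Require Import all_boot all_order all_algebra.
From mathcomp Require Import all_classical all_reals all_analysis.

Local Open Scope classical_set_scope.

(** A local section through the germ is equivariant as it stands, once its
domain has been shrunk enough; the reason is compactness of [K].

Take an open [U] containing the germ on which [sproj] is injective, with inverse
[t] continuous on the open set [D], the image of [U].  The Weyl condition says
that every [k] in [K] fixes the germ, so the continuous map sending [(g, L)] to
[g t(g^-1 L g)] takes the value [t K] at [(k, K)], and stays in [U] for [(g, L)]
near [(k, K)].  As [K] is compact, one neighbourhood [W] of [K] and one
neighbourhood [A] of [1] suffice for all of the points [(n k, L)] with [n] in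
[A], [k] in [K] and [L] in [W].  For these, [g t(g^-1 L g)] and [t L] are two
points of [U] over [L], hence equal: [t] is already equivariant, without any
averaging.

It remains to find [N] with [N] contained in [A] and [O_(NK)(N, NK)] contained
in [W] and [D].  The first is [profinite_nbhs1], the fact that the open normal
subgroups of a profinite group form a neighbourhood basis of [1]; the second is
[nbhs_csgP], the fact that the sets [O_(NK)(N, NK)] form a neighbourhood basis
of [K].  Both conditions persist for smaller [N], so they can be met together.

Continuity of the conjugation action at the points [(k, K)] follows from the
same basis, because [NK] is an open set containing [k] whose elements conjugate
[O_(NK)(N, NK)] into itself ([conj_csgV_cvg]). *)

(** * Compact totally disconnected Hausdorff spaces *)

Section QuasiComponents.
Variable T : topologicalType.
Hypotheses (cT : compact [set: T]) (hT : hausdorff_space T).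

Definition quasi_component (x : T) : set T :=
  \bigcap_(C in [set C | clopen C /\ C x]) C.

(** Compactness applies to the filter generated by the clopen sets around [x]
intersected with the complement of [W]: a cluster point would lie in each of
these clopen sets, hence in [W], and also in the complement of [W]. *)
Lemma quasi_component_nbhs (x : T) (W : set T) : open W ->
  quasi_component x `<=` W -> exists C, [/\ clopen C, C x & C `<=` W].
Proof.
move=> oW QW.
apply: contrapT => noC.
have PF : ProperFilter (filter_from [set C : set T | clopen C /\ C x]
    (fun C => C `&` ~` W)).
  apply: filter_from_proper; first apply: filter_from_filter.
  - by exists setT; split => //; exact: clopenT.
  - move=> A B [? ?] [? ?]; exists (A `&` B).
      by split=> //; exact: clopenI.
    by move=> z [[? ?] ?].
  - move=> C [cC Cx]; apply: contrapT => CW; apply: noC; exists C; split => //.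
    by move=> z Cz; apply: contrapT => Wz; apply: CW; exists z.
have [|y [_ yF]] := cT _ PF.
  by exists setT => //; split => //; exact: clopenT.
have Qy : quasi_component x y.
  move=> C [cC Cx]; have [_ clC] := cC; apply: clC => B yB.
  have FC : filter_from [set C : set T | clopen C /\ C x]
      (fun C => C `&` ~` W) C.
    by exists C; [|move=> z []].
  exact: yF.
have [z [Wz Wz']] : (~` W) `&` W !=set0.
  apply: yF; last by apply: open_nbhs_nbhs; split => //; exact: QW.
  by exists setT; [split => //; exact: clopenT|move=> z []].
exact: Wz.
Qed.

(** Normality gives an open [U] around [A] whose closure misses [B].  A clopen
[C] around the quasi-component that avoids the boundary of [U] meets [U] in a
clopen set, which contains [x] and so contains the whole quasi-component. *)
Lemma quasi_component_closed_split (x : T) (A B : set T) :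
  closed A -> closed B -> A `&` B = set0 -> quasi_component x = A `|` B ->
  A x -> B = set0.
Proof.
move=> cA cB AB QAB Ax.
have nA : set_nbhs A (~` B).
  move=> a Aa; apply: open_nbhs_nbhs; split; first exact: closed_openC.
  by move=> Ba; have : (A `&` B) a by []; rewrite AB.
have [V /set_nbhsP [U [oU AU UV]] VB] := compact_normal hT cT cA nA.
have [||C [[oC cC] Cx CUV]] := @quasi_component_nbhs x (U `|` ~` closure V).
- apply: openU => //; apply: closed_openC; exact: closed_closure.
- by rewrite QAB => z [/AU|Bz]; [left|right => /VB].
have CU : C `&` U = C `&` closure V.
  apply/seteqP; split => z [Cz zU]; split => //; first exact/subset_closure/UV.
  by case: (CUV _ Cz).
rewrite -subset0 => b Bb.
have : quasi_component x b by rewrite QAB; right.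
move=> /(_ (C `&` U)) [].
  split; last by split => //; exact: AU.
  split; first exact: openI.
  by rewrite CU; apply: closedI => //; exact: closed_closure.
by move=> _ /UV /subset_closure /VB.
Qed.

(** A relatively clopen part [B] and its complement are both closed in [T], the
quasi-component being closed; the one of them that contains [x] is everything. *)
Lemma quasi_component_connected (x : T) : connected (quasi_component x).
Proof.
move=> B [b Bb] [C oC BC] [D cD BD].
have cQ : closed (quasi_component x) by apply: closed_bigI => A [[]].
have cB : closed B by rewrite BD; exact: closedI.
have cB' : closed (quasi_component x `&` ~` C).
  by apply: closedI => //; exact: open_closedC.
have BB' : B `&` (quasi_component x `&` ~` C) = set0.
  by rewrite -subset0 BC => z [[_ ?] [_]].
have QBB' : quasi_component x = B `|` (quasi_component x `&` ~` C).
  by rewrite BC -setIUr setUv setIT.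
have Qx : quasi_component x x by move=> A [].
have [Bx|B'x] : B x \/ (quasi_component x `&` ~` C) x by rewrite QBB' in Qx.
  have B'0 := quasi_component_closed_split _ _ _ cB cB' BB' QBB' Bx.
  by rewrite QBB' B'0 setU0.
rewrite setIC in BB'; rewrite setUC in QBB'.
have B0 := quasi_component_closed_split _ _ _ cB' cB BB' QBB' B'x.
by rewrite B0 in Bb.
Qed.

(** Quasi-components, being connected, are contained in components, and so they
are singletons here. *)
Lemma compact_totally_disconnected_zero_dimensional :
  totally_disconnected [set: T] -> zero_dimensional T.
Proof.
move=> dT x y xy; apply: contrapT => noC.
have Qy : quasi_component x y.
  by move=> C [cC Cx]; apply: contrapT => Cy; apply: noC; exists C.
have : connected_component [set: T] x y.
  exists (quasi_component x) => //; split => //; first by move=> C [].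
  exact: quasi_component_connected.
by rewrite dT// => /= yx; rewrite yx eqxx in xy.
Qed.

End QuasiComponents.

(** * Open normal subgroups of a profinite group *)

Lemma clopen_cvg_near (T : topologicalType) (I : Type) (F : set_system I)
    (C : set T) (f g : I -> T) (c : T) :
  Filter F -> clopen C -> f @ F --> c -> g @ F --> c ->
  \forall i \near F, C (f i) <-> C (g i).
Proof.
move=> FF [oC cC] fc gc.
have [Cc|nCc] := pselect (C c).
  have nC : nbhs c C by exact: open_nbhs_nbhs.
  have fC : F (f @^-1` C) := fc _ nC.
  have gC : F (g @^-1` C) := gc _ nC.
  by apply: filterS2 fC gC => i.
have nC : nbhs c (~` C).
  by apply: open_nbhs_nbhs; split => //; exact: closed_openC.
have fC : F (f @^-1` (~` C)) := fc _ nC.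
have gC : F (g @^-1` (~` C)) := gc _ nC.
by apply: filterS2 fC gC => i.
Qed.

Section TopologicalGroups.
Variable G : topologicalGroupType.
Implicit Types (N : set G) (K L : closed_subgroup G).

Lemma cvgMg (I : Type) (F : set_system I) (f g : I -> G) (a b : G) :
  Filter F -> f @ F --> a -> g @ F --> b ->
  (fun i => (f i * g i)%g) @ F --> (a * b)%g.
Proof.
move=> FF fa gb.
exact: (continuous2_cvg FF (@mulg_continuous G (a, b)) fa gb).
Qed.

Lemma mulg_nearP (C : set G) (a n b : G) : clopen C ->
  \forall xy \near (a, b) & m \near n,
    C (xy.1 * m * xy.2)%g <-> C (xy.1 * n * xy.2)%g.
Proof.
move=> cC.
have cv1 : (fun z : G * G * G => (z.1.1 * z.2 * z.1.2)%g)
    @ nbhs ((a, b), n) --> (a * n * b)%g.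
  apply: cvgMg; first apply: cvgMg.
  - exact: (cvg_comp fst fst (G := nbhs (a, b)) cvg_fst cvg_fst).
  - exact: cvg_snd.
  - exact: (cvg_comp fst snd (G := nbhs (a, b)) cvg_fst cvg_snd).
have cv2 : (fun z : G * G * G => (z.1.1 * n * z.1.2)%g)
    @ nbhs ((a, b), n) --> (a * n * b)%g.
  apply: cvgMg; first apply: cvgMg.
  - exact: (cvg_comp fst fst (G := nbhs (a, b)) cvg_fst cvg_fst).
  - exact: cvg_cst.
  - exact: (cvg_comp fst snd (G := nbhs (a, b)) cvg_fst cvg_snd).
by apply: clopen_cvg_near cC cv1 cv2.
Qed.

(** The class of [1] under the syntactic congruence of [C].  Since [x] and [y]
range over the whole group, this is the largest normal subgroup [N] such that
[C] is a union of cosets of [N]. *)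
Definition syntactic_kernel (C : set G) : set G :=
  [set n | forall x y, C (x * n * y)%g <-> C (x * y)%g].

(** Openness is a tube lemma: membership in the clopen set [C] of [x m y] and of
[x n y] agree for [m] near [n], uniformly in [(x, y)] since the square of the
group is compact. *)
Lemma syntactic_kernel_open_normal (C : set G) :
  compact [set: G] -> clopen C -> open_normal_subgroup (syntactic_kernel C).
Proof.
move=> cG cC.
have normal g n : syntactic_kernel C n -> syntactic_kernel C (g * n * g^-1)%g.
  move=> kn x y; have := kn (x * g)%g (g^-1 * y)%g.
  by rewrite !mulgA mulgK.
split.
- split.
  + by move=> x y; rewrite mulg1.
  + move=> m n km kn x y; rewrite mulgA -(km x y) -(kn (x * m)%g y).
    by split.
  + by move=> n kn x y; have := kn (x * n^-1)%g y; rewrite mulgVK => ->.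
- rewrite openE => n kn.
  have /compact_near_coveringP nG : compact ([set: G] `*` [set: G]).
    exact: compact_setX.
  have : \forall m \near n, [set: G] `*` [set: G] `<=`
      [set xy | C (xy.1 * m * xy.2)%g <-> C (xy.1 * n * xy.2)%g].
    by apply: nG => -[a b] _; exact: mulg_nearP.
  apply: filterS => m mn x y; rewrite -(kn x y).
  exact: (mn (x, y)).
- move=> g; apply/seteqP; split => [_ [n kn <-]|n kn]; first exact: normal.
  exists (g^-1 * n * g)%g; last by rewrite !mulgA mulgV mul1g mulgK.
  by have := normal g^-1%g n kn; rewrite invgK.
Qed.

Lemma profinite_nbhs1 (A : set G) : profinite G -> nbhs 1%g A ->
  exists N, open_normal_subgroup N /\ N `<=` A.
Proof.
move=> [cG hG dG] nA.
have zG := compact_totally_disconnected_zero_dimensional _ cG hG dG.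
have [C [C1 cC] CA] := zero_dimensional_cvg hG zG cG nA.
exists (syntactic_kernel C); split; first exact: syntactic_kernel_open_normal.
by move=> n kn; apply: CA; have := kn 1%g 1%g; rewrite !mulg1 mul1g => ->.
Qed.

Lemma open_normal_subgroupT : open_normal_subgroup [set: G].
Proof.
split=> //; first exact: openT.
move=> g; apply/seteqP; split => // x _; exists (g^-1 * x * g)%g => //.
by rewrite !mulgA mulgV mul1g mulgK.
Qed.

Lemma open_normal_subgroup_conj N g n : open_normal_subgroup N -> N n ->
  N (g * n * g^-1)%g.
Proof. by move=> [_ _ nN] Nn; rewrite -(nN g); exists n. Qed.

Lemma open_normal_subgroupI N1 N2 : open_normal_subgroup N1 ->
  open_normal_subgroup N2 -> open_normal_subgroup (N1 `&` N2).
Proof.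
move=> oN1 oN2.
have [[N11 N1M N1V] oN1' _] := oN1; have [[N21 N2M N2V] oN2' _] := oN2; split.
- split=> // [x y [? ?] [? ?]|x [? ?]].
    by split; [exact: N1M|exact: N2M].
  by split; [exact: N1V|exact: N2V].
- exact: openI.
have conjI g n : (N1 `&` N2) n -> (N1 `&` N2) (g * n * g^-1)%g.
  by case=> ? ?; split; exact: open_normal_subgroup_conj.
move=> g; apply/seteqP; split => [_ [n Nn <-]|n Nn]; first exact: conjI.
exists (g^-1 * n * g)%g; last by rewrite !mulgA mulgV mul1g mulgK.
by have := conjI g^-1%g n Nn; rewrite invgK.
Qed.

(** * The topology of the space of closed subgroups *)

Lemma mulset_subP N A B : subgroup N ->
  mulset N A `<=` mulset N B <-> A `<=` mulset N B.
Proof.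
move=> [N1 NM _]; split => [sAB a Aa|sAB _ [n Nn [a Aa <-]]].
  by apply: sAB; exists 1%g => //; exists a => //; rewrite mul1g.
have [m Nm [b Bb <-]] := sAB _ Aa.
by exists (n * m)%g; [exact: NM|exists b => //; rewrite mulgA].
Qed.

Lemma mulset_eqS N N' A B : subgroup N -> subgroup N' -> N `<=` N' ->
  mulset N A = mulset N B -> mulset N' A = mulset N' B.
Proof.
move=> gN gN' NN'.
wlog suff sub : A B / mulset N A = mulset N B -> mulset N' A `<=` mulset N' B.
  by move=> AB; apply/seteqP; split; exact: sub.
move=> AB; apply/mulset_subP => //.
have sAB : A `<=` mulset N B by apply/mulset_subP => //; rewrite AB.
by move=> a /sAB [n /NN' Nn [b Bb <-]]; exists n => //; exists b.
Qed.

(** Both sides say that [A] and [B] meet the same cosets of [N], which may be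
read as left or right cosets because [N] is normal. *)
Lemma quotient_imageP N A B : open_normal_subgroup N ->
  quotient_image A N = quotient_image B N <-> mulset N A = mulset N B.
Proof.
move=> nN; have [gN _ _] := nN; have [N1 NM NV] := gN; split.
  wlog suff sub : A B / quotient_image A N = quotient_image B N ->
      mulset N A `<=` mulset N B.
    by move=> AB; apply/seteqP; split; exact: sub.
  move=> AB; apply/mulset_subP => // a Aa.
  have [b Bb bNaN] : quotient_image B N [set (a * n)%g | n in N].
    by rewrite -AB; exists a.
  have [n Nn <-] : [set (b * n)%g | n in N] a.
    by rewrite bNaN; exists 1%g => //; rewrite mulg1.
  exists (b * n * b^-1)%g; first exact: open_normal_subgroup_conj.
  by exists b => //; rewrite mulgVK.
wlog suff sub : A B / mulset N A = mulset N B ->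
    quotient_image A N `<=` quotient_image B N.
  by move=> AB; apply/seteqP; split; exact: sub.
move=> AB _ [a Aa <-].
have sAB : A `<=` mulset N B by apply/mulset_subP => //; rewrite AB.
have [n Nn [b Bb <-]] := sAB _ Aa.
exists b => //; apply/seteqP; split => _ [m Nm <-].
  exists (b^-1 * n^-1 * b * m)%g; last by rewrite !mulgA mulgK mulgV mul1g.
  apply: NM => //; have := open_normal_subgroup_conj _ b^-1%g _ nN (NV _ Nn).
  by rewrite invgK.
exists (b^-1 * n * b * m)%g; last by rewrite !mulgA mulgV mul1g.
apply: NM => //; have := open_normal_subgroup_conj _ b^-1%g _ nN Nn.
by rewrite invgK.
Qed.

(** [N L = N K] already forces [L] to be contained in [N K]. *)
Lemma O_mulsetE N K : subgroup N ->
  O_ (mulset N K) N (mulset N K) =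
  [set L : closed_subgroup G | mulset N L = mulset N K].
Proof.
move=> gN; apply/seteqP; split => [L []//|L /= LK]; split => //.
by apply/mulset_subP => //; rewrite LK.
Qed.

Lemma O_subset N N' K : subgroup N -> subgroup N' -> N `<=` N' ->
  O_ (mulset N K) N (mulset N K) `<=` O_ (mulset N' K) N' (mulset N' K).
Proof.
by move=> gN gN' NN'; rewrite !O_mulsetE// => L /=; exact: mulset_eqS.
Qed.

Lemma csg_inj K L : csg K = csg L -> K = L.
Proof.
case: K L => A gA cA [B gB cB] /= AB; subst B.
by rewrite (Prop_irrelevance gA gB) (Prop_irrelevance cA cB).
Qed.

(** This set is a cylinder: membership depends on the coordinate indexed by [N]
alone. *)
Lemma open_O_ N K : open_normal_subgroup N ->
  open (O_ (mulset N K) N (mulset N K)).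
Proof.
move=> nN; have [gN _ _] := nN; rewrite O_mulsetE//.
pose i : set_type (@open_normal_subgroup G) := SigSub (mem_set nN).
pose A : set (prod_topology (fun _ : set_type (@open_normal_subgroup G) =>
  discrete_topology (set (set G)))) := [set f | f i = quotient_image K N].
have -> : [set L : closed_subgroup G | mulset N L = mulset N K] =
    @to_finite_quotients G @^-1` A.
  by apply/seteqP; split => L /=; rewrite /A /= quotient_imageP.
have oA : open A.
  have -> : A = proj i @^-1` [set quotient_image K N] by [].
  apply: open_comp; last exact: discrete_open.
  by move=> f _; exact: proj_continuous.
by exists A.
Qed.

Lemma cvg_initial (S : choiceType) (T : topologicalType) (f : S -> T)
    (F : set_system S) (s : S) :
  Filter F -> f @ F --> f s -> F --> (s : initial_topology f).
Proof.
move=> FF fFs A [_ [[B Bop <-] Bfs] sBA].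
by apply: filterS sBA _; apply: fFs; exact: open_nbhs_nbhs.
Qed.

(** The sets [O_(NK)(N, NK)] decrease with [N] and hence generate a filter,
since two open normal subgroups contain their intersection.  That filter
converges to [K] because on [O_(NK)(N, NK)] the coordinate indexed by [N] is
constant. *)
Lemma nbhs_csgP K (W : set (closed_subgroup G)) : nbhs K W ->
  exists N, open_normal_subgroup N /\ O_ (mulset N K) N (mulset N K) `<=` W.
Proof.
pose F := filter_from (@open_normal_subgroup G)
  (fun N => O_ (mulset N K) N (mulset N K)).
have FF : Filter F.
  apply: filter_from_filter; first by exists setT; exact: open_normal_subgroupT.
  move=> N1 N2 nN1 nN2; exists (N1 `&` N2); first exact: open_normal_subgroupI.
  have [[gN1 _ _] [gN2 _ _]] := (nN1, nN2).
  have [gN _ _] := open_normal_subgroupI _ _ nN1 nN2.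
  by rewrite subsetI; split; apply: O_subset => // x [].
suff FK : F --> K by move=> /FK [N nN NW]; exists N.
apply: (cvg_initial (closed_subgroup G) _ (@to_finite_quotients G)).
apply/cvg_sup => i.
apply: cvg_initial.
apply/discrete_cvg.
exists (set_val i); first exact: set_valP.
have nN : open_normal_subgroup (set_val i) by exact: set_valP.
have [gN _ _] := nN.
by rewrite O_mulsetE// => L /= /quotient_imageP; exact.
Qed.

(** * Conjugation *)

Lemma conj_csgV g K : conj_csg g (conj_csg g^-1%g K) = K.
Proof.
apply: csg_inj; apply/seteqP; split => [_ [_ [k Kk <-] <-]|k Kk] /=.
  by rewrite invgK !mulgA mulgV mul1g mulgK.
exists (g^-1 * k * g)%g; last by rewrite !mulgA mulgV mul1g mulgK.
by exists k => //; rewrite invgK.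
Qed.

Lemma mulset_subgroup N K : open_normal_subgroup N -> subgroup (mulset N K).
Proof.
move=> nN; have [[N1 NM NV] _ _] := nN; have [K1 KM KV] := csg_subgroup K.
split.
- by exists 1%g => //; exists 1%g => //; rewrite mulg1.
- move=> _ _ [n Nn [k Kk <-]] [m Nm [l Kl <-]].
  exists (n * (k * m * k^-1))%g.
    by apply: NM => //; exact: open_normal_subgroup_conj.
  by exists (k * l)%g; [exact: KM|rewrite !mulgA mulgVK].
- move=> _ [n Nn [k Kk <-]]; exists (k^-1 * n^-1 * k)%g.
    have := open_normal_subgroup_conj _ k^-1%g _ nN (NV _ Nn).
    by rewrite invgK.
  by exists k^-1%g; [exact: KV|rewrite mulgK invgM].
Qed.

Lemma O_invariant N K : open_normal_subgroup N ->
  invariant_under (mulset N K) (O_ (mulset N K) N (mulset N K)).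
Proof.
move=> nN g L Jg; have [gN _ _] := nN; have [N1 NM NV] := gN.
have [_ JM JV] := mulset_subgroup N K nN.
have NJ : N `<=` mulset N K.
  have [K1 _ _] := csg_subgroup K.
  by move=> n Nn; exists n => //; exists 1%g => //; rewrite mulg1.
rewrite O_mulsetE// => LK /=.
have LJ : L `<=` mulset N K by apply/mulset_subP => //; rewrite LK.
apply/seteqP; split => [_ [n Nn [_ [l Ll <-] <-]]|j Jj].
  apply: (JM); first exact: NJ.
  by apply: (JM); [apply: (JM) => //; exact: LJ|exact: JV].
have : mulset N K (g^-1 * j * g)%g.
  by apply: (JM) => //; apply: (JM) => //; exact: JV.
rewrite -LK => -[n Nn [l Ll nl]].
exists (g * n * g^-1)%g; first exact: open_normal_subgroup_conj.
exists (g * l * g^-1)%g; first by exists l.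
have -> : (g * n * g^-1 * (g * l * g^-1))%g = (g * (n * l) * g^-1)%g.
  by rewrite !mulgA mulgVK.
by rewrite nl !mulgA mulgV mul1g mulgK.
Qed.

Lemma O_self N K : subgroup N -> O_ (mulset N K) N (mulset N K) K.
Proof. by move=> gN; rewrite O_mulsetE. Qed.

(** Given a basic neighbourhood [O_(NK)(N, NK)] of [K], the elements of [N K],
which is a neighbourhood of [k], conjugate it into itself. *)
Lemma conj_csgV_cvg K k : csg K k ->
  (fun gL : G * closed_subgroup G => conj_csg gL.1^-1%g gL.2)
    @ nbhs (k, K) --> K.
Proof.
move=> Kk W /nbhs_csgP [N [nN NW]]; have [gN oN _] := nN.
have Nk : \forall g \near k, mulset N K g.
  have cv : (fun g => (g * k^-1)%g) @ k --> (1%g : G).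
    by rewrite -(mulgV k); apply: cvgMg; [exact: cvg_id|exact: cvg_cst].
  have nb : nbhs (1%g : G) N by apply: open_nbhs_nbhs; split => //; case: gN.
  have : nbhs k [set g | N (g * k^-1)%g] := cv _ nb.
  apply: filterS => g Ng; exists (g * k^-1)%g => //.
  by exists k => //; rewrite mulgVK.
have OK : nbhs K (O_ (mulset N K) N (mulset N K)).
  by apply: open_nbhs_nbhs; split; [exact: open_O_|exact: O_self].
exists (mulset N K, O_ (mulset N K) N (mulset N K)) => //.
move=> [g L] [/= Jg OL]; apply: NW; apply: O_invariant => //.
by have [_ _ JV] := mulset_subgroup N K nN; exact: JV.
Qed.

End TopologicalGroups.

(** * Equivariant sections *)

Theorem proposition3 (G : topologicalGroupType) (hG : profinite G)
    (E : Gsheaf G) (hE : Weyl E)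
    (K : closed_subgroup G) (sK : stalk E K) :
  exists N : set G, open_normal_subgroup N /\
    exists s : closed_subgroup G -> E,
      let NK := mulset N K in
      [/\ open_nbhs K (O_ NK N NK),
          is_section (O_ NK N NK) s,
          equivariant_on NK (O_ NK N NK) s &
          s K = sval sK].
Proof.
have [homeo _ _] := sheaf_spaceP E.
have [U [t [[oU UsK] oD _ ct tU]]] := homeo (sval sK).
have pK : sproj (sval sK) = K := svalP sK.
set D := (sproj (s:=E)) @` U in oD ct.
have DK : D K by exists (sval sK).
have tK : t K = sval sK by rewrite -[in LHS]pK tU.
have pt L : D L -> sproj (t L) = L by move=> [u Uu <-]; rewrite tU.
have t_cvg : t @ K --> sval sK.
  rewrite -tK; move: ct; rewrite continuous_open_subspace// => ct.
  by apply: ct; exact: mem_set.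
pose good (g : G) (L : closed_subgroup G) :=
  D (conj_csg g^-1%g L) /\ U (gact g (t (conj_csg g^-1%g L))).
have good_near k : csg K k -> nbhs (k, K) [set gL | good gL.1 gL.2].
  move=> Kk; have cK := conj_csgV_cvg _ K k Kk.
  have act_cvg : (fun gL : G * closed_subgroup G =>
      gact gL.1 (t (conj_csg gL.1^-1%g gL.2))) @ nbhs (k, K) --> sval sK.
    have -> : sval sK = gact k (sval sK) by rewrite (hE K).
    apply: (continuous2_cvg _ (@gact_continuous _ E (k, sval sK))).
      exact: cvg_fst.
    exact: (cvg_comp _ _ cK t_cvg).
  have nD : nbhs (k, K) [set gL | D (conj_csg gL.1^-1%g gL.2)].
    by apply: cK; exact: open_nbhs_nbhs.
  have nU : nbhs (k, K) [set gL | U (gact gL.1 (t (conj_csg gL.1^-1%g gL.2)))].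
    by apply: act_cvg; exact: open_nbhs_nbhs.
  by apply: filterS2 nD nU.
have [cG _ _] := hG.
have /compact_near_coveringP cK : compact (csg K).
  by apply: (subclosed_compact _ cG) => //; exact: csg_closed.
(* One neighbourhood of (1, K) serves every k in K. *)
have := cK _ (nbhs ((1%g : G), K)) (fun nL k => good (nL.1 * k)%g nL.2) _ _.
case.
  move=> k Kk.
  have cv : (fun z : G * (G * closed_subgroup G) => ((z.2.1 * z.1)%g, z.2.2))
      @ nbhs (k, ((1%g : G), K)) --> (k, K).
    have cv1 : (fun z : G * (G * closed_subgroup G) => (z.2.1 * z.1)%g)
        @ nbhs (k, ((1%g : G), K)) --> k.
      rewrite -[X in _ --> X](mul1g k); apply: cvgMg.
        exact: (cvg_comp snd fst (G := nbhs ((1%g : G), K)) cvg_snd cvg_fst).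
      exact: cvg_fst.
    have cv2 : (fun z : G * (G * closed_subgroup G) => z.2.2)
        @ nbhs (k, ((1%g : G), K)) --> K.
      exact: (cvg_comp snd snd (G := nbhs ((1%g : G), K)) cvg_snd cvg_snd).
    exact: (@cvg_pair _ _ _ _ (nbhs k) (nbhs K) _ _ _ _ _ cv1 cv2).
  exact: (cv _ (good_near k Kk)).
move=> [A W] /= [nA nW] AW.
have [N1 [nN1 N1A]] := profinite_nbhs1 _ A hG nA.
have nWD : nbhs K (W `&` D) by apply: filterI => //; exact: open_nbhs_nbhs.
have [N2 [nN2 N2W]] := nbhs_csgP _ K (W `&` D) nWD.
have nN := open_normal_subgroupI _ _ _ nN1 nN2.
exists (N1 `&` N2); split => //.
set N := N1 `&` N2 in nN *; exists t; set NK := mulset N K.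
have [[gN _ _] [gN2 _ _]] := (nN, nN2).
have OWD : O_ NK N NK `<=` W `&` D.
  by apply: subset_trans N2W; apply: O_subset => // x [].
split=> //.
- by split; [exact: open_O_|exact: O_self].
- split; [exact: open_O_| |by move=> L /OWD [_ /pt]].
  by apply: continuous_subspaceW ct => L /OWD [].
- split; first exact: O_invariant.
  move=> _ L [n [N1n _] [k Kk <-]] /OWD [WL _].
  have [DL UL] : good (n * k)%g L.
    by apply: (AW (n, L)) => //; split => //; exact: N1A.
  (* Both sides are points of U over L. *)
  by rewrite -(tU _ UL) sproj_gact pt// conj_csgV.
Qed.
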